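(* Let $S\subset\mathbb{R}^n/\mathbb{R}\mathbf{1}$ be a finite set and let $x$ and $y$ be points in the complement of the braid arrangement $\mathcal{B}_n(S)$ of $S$. Then $\mathrm{type}(x,S)=\mathrm{type}(y,S)$ if $x$ and $y$ are in the same chamber of the braid arrangement of $S$.
   Context: $\mathbf{1}=(1,\dots,1)$, and $\mathbb{R}^n/\mathbb{R}\mathbf{1}$ is the tropical projective torus (vectors differing by a real multiple of $\mathbf{1}$ are identified). The tropical metric is $d_{\mathrm{tr}}(x,y)=\max_i(x_i-y_i)-\min_i(x_i-y_i)$. The braid arrangement $\mathcal{B}_n$ in $\mathbb{R}^n/\mathbb{R}\mathbf{1}$ is the hyperplane arrangement consisting of the hyperplanes $x_i-x_j=0$ for $1\le j<i\le n$. The braid arrangement $\mathcal{B}_n(p)$ at $p$ is its translate in which the origin is moved to $p$, i.e. it consists of the hyperplanes $x_i-x_j=p_i-p_j$. The braid arrangement $\mathcal{B}_n(S)$ of a finite set $S$ is the union of the arrangements $\mathcal{B}_n(p)$, $p\in S$. Chambers are the regions (connected components) of the complement of the arrangement. For $x$ in the complement of $\mathcal{B}_n(p)$, $\mathrm{type}(x,p)$ is the unordered pair $\{i,j\}\in\binom{[n]}{2}$ such that $d_{\mathrm{tr}}(x,p)^2=(x_i-x_j-(p_i-p_j))^2$. For a finite set $S$, $\mathrm{type}(x,S)=\{\mathrm{type}(x,p) : p\in S\}$. *)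

(* Defs.v *)
From HB Require Import structures.
From mathcomp Require Import all_boot all_order all_algebra.
From mathcomp Require Import all_classical all_reals all_analysis.
From mathcomp Require Import lra.

Set Implicit Arguments.
Unset Strict Implicit.
Unset Printing Implicit Defensive.

Import Order.TTheory GRing.Theory Num.Theory.
Import numFieldNormedType.Exports.

Local Open Scope classical_set_scope.
Local Open Scope ring_scope.
Local Open Scope quotient_scope.

Section TropicalProjectiveTorus.
Context {R : realType} {n : nat}.

(* Coordinates are indexed by 'I_n.+1, so tp_torus R n is R^{n+1} modulo the
   all-ones vector, and every vector has a maximal and a minimal coordinate. *)
Implicit Types u v : 'rV[R]_n.+1.

Definition tp_equiv u v : bool := `[< exists c : R, u = v + const_mx c >].

Lemma tp_equiv_refl : reflexive tp_equiv.
Proof.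
move=> u; apply/asboolP; exists 0.
by apply/rowP => i; rewrite !mxE addr0.
Qed.

Lemma tp_equiv_sym : symmetric tp_equiv.
Proof.
suff H u v : tp_equiv u v -> tp_equiv v u by move=> u v; apply/idP/idP; exact: H.
move=> /asboolP[c ->]; apply/asboolP; exists (- c).
by apply/rowP => i; rewrite !mxE addrK.
Qed.

Lemma tp_equiv_trans : transitive tp_equiv.
Proof.
move=> v u w /asboolP[c ->] /asboolP[d ->]; apply/asboolP; exists (d + c).
by apply/rowP => i; rewrite !mxE addrA.
Qed.

Canonical tp_equiv_rel :=
  EquivRel tp_equiv tp_equiv_refl tp_equiv_sym tp_equiv_trans.

Definition tp_torus : topologicalType :=
  quotient_topology {eq_quot tp_equiv_rel}.

Definition tp_class u : tp_torus := \pi_{eq_quot tp_equiv_rel} u.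
Definition tp_repr (x : tp_torus) : 'rV[R]_n.+1 :=
  repr (x : {eq_quot tp_equiv_rel}).

Implicit Types x y p : tp_torus.

(* x_i - x_j, which does not depend on the representative: see coord_diffE. *)
Definition coord_diff x (i j : 'I_n.+1) : R :=
  tp_repr x ord0 i - tp_repr x ord0 j.

Definition max_coord u : R := \big[Num.max/u ord0 ord0]_(i < n.+1) u ord0 i.
Definition min_coord u : R := \big[Num.min/u ord0 ord0]_(i < n.+1) u ord0 i.

(* Independent of the representatives: see trop_distE. *)
Definition trop_dist x y : R :=
  max_coord (tp_repr x - tp_repr y) - min_coord (tp_repr x - tp_repr y).

Definition braid_hyperplane p (i j : 'I_n.+1) : set tp_torus :=
  [set x | coord_diff x i j = coord_diff p i j].

Definition braid_at p : set (set tp_torus) :=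
  [set H | exists i j : 'I_n.+1, (j < i)%N /\ H = braid_hyperplane p i j].

Definition braid_arrangement (S : set tp_torus) : set (set tp_torus) :=
  \bigcup_(p in S) braid_at p.

Definition arr_complement (A : set (set tp_torus)) : set tp_torus :=
  ~` \bigcup_(H in A) H.

Definition chambers (A : set (set tp_torus)) : set (set tp_torus) :=
  [set connected_component (arr_complement A) x | x in arr_complement A].

Definition is_type x p (A : {set 'I_n.+1}) : Prop :=
  exists i j : 'I_n.+1, [/\ i != j, A = [set i; j]%SET &
    trop_dist x p ^+ 2 = (coord_diff x i j - coord_diff p i j) ^+ 2].

(* The set A with is_type x p A; by type_ofP and type_of_uniq it exists and is
   unique for x off the arrangement at p, as soon as there are at least two
   coordinates. The default set0 is not a pair. *)
Definition type_of x p : {set 'I_n.+1} := xget finset.set0 (is_type x p).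

Definition types x (S : set tp_torus) : set {set 'I_n.+1} :=
  [set type_of x p | p in S].

Lemma tp_reprK x : tp_class (tp_repr x) = x.
Proof. exact: reprK. Qed.

Lemma tp_classP u v :
  tp_class u = tp_class v <-> exists c : R, u = v + const_mx c.
Proof.
by split=> [/eqmodP/asboolP//|uv]; apply/eqmodP/asboolP.
Qed.

Lemma tp_repr_class u : exists c : R, tp_repr (tp_class u) = u + const_mx c.
Proof. by apply/tp_classP; rewrite tp_reprK. Qed.

Lemma coord_diffE u i j : coord_diff (tp_class u) i j = u ord0 i - u ord0 j.
Proof.
rewrite /coord_diff; have [c ->] := tp_repr_class u.
by rewrite !mxE opprD addrACA subrr addr0.
Qed.

Lemma le_max_coord u i : u ord0 i <= max_coord u.
Proof. exact: le_bigmax. Qed.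

Lemma ge_min_coord u i : min_coord u <= u ord0 i.
Proof. exact: bigmin_le. Qed.

Lemma max_coord_attained u : exists i, max_coord u = u ord0 i.
Proof.
rewrite /max_coord; apply: (big_ind (fun t => exists i, t = u ord0 i)).
- by exists ord0.
- by move=> a b [i ->] [j ->]; case: leP => _; [exists j|exists i].
- by move=> i _; exists i.
Qed.

Lemma min_coord_attained u : exists i, min_coord u = u ord0 i.
Proof.
rewrite /min_coord; apply: (big_ind (fun t => exists i, t = u ord0 i)).
- by exists ord0.
- by move=> a b [i ->] [j ->]; case: leP => _; [exists i|exists j].
- by move=> i _; exists i.
Qed.

Lemma spread_shift u (c : R) :
  max_coord (u + const_mx c) - min_coord (u + const_mx c) =
  max_coord u - min_coord u.
Proof.
have [i1 e1] := max_coord_attained u.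
have [j1 f1] := min_coord_attained u.
have [i2 e2] := max_coord_attained (u + const_mx c).
have [j2 f2] := min_coord_attained (u + const_mx c).
have := le_max_coord u i2; have := ge_min_coord u j2.
have := le_max_coord (u + const_mx c) i1.
have := ge_min_coord (u + const_mx c) j1.
rewrite e1 f1 e2 f2 !mxE.
move: (u ord0 i1) (u ord0 j1) (u ord0 i2) (u ord0 j2) => a b a' b' ? ? ? ?.
lra.
Qed.

Lemma trop_distE u v : trop_dist (tp_class u) (tp_class v) =
  max_coord (u - v) - min_coord (u - v).
Proof.
rewrite /trop_dist.
have [c ->] := tp_repr_class u; have [d ->] := tp_repr_class v.
rewrite -(spread_shift (u - v) (c - d)).
suff -> : u + const_mx c - (v + const_mx d) = u - v + const_mx (c - d) by [].
by apply/rowP => i; rewrite !mxE opprD addrACA.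
Qed.

Lemma type_ofP x p : (0 < n)%N -> arr_complement (braid_at p) x ->
  is_type x p (type_of x p).
Proof.
move=> n0 xp; apply: (@xgetPex _ finset.set0 (is_type x p)).
set w := tp_repr x - tp_repr p.
have [i wi] := max_coord_attained w; have [j wj] := min_coord_attained w.
have winj (a b : 'I_n.+1) : (b < a)%N -> w ord0 a <> w ord0 b.
  move=> ba wab; apply: xp; exists (braid_hyperplane p a b); first by exists a, b.
  by move: wab; rewrite /braid_hyperplane /= /coord_diff !mxE => ?; lra.
exists [set i; j]%SET, i, j; split => //; last first.
  rewrite /trop_dist -/w wi wj /coord_diff !mxE; congr (_ ^+ 2); lra.
apply/eqP => ij.
apply: (winj ord_max ord0) => //.
have := le_max_coord w ord_max; have := le_max_coord w ord0.
have := ge_min_coord w ord_max; have := ge_min_coord w ord0.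
by rewrite wi wj -ij => ? ? ? ?; lra.
Qed.

Lemma type_of_uniq x p A : arr_complement (braid_at p) x ->
  is_type x p A -> type_of x p = A.
Proof.
move=> xp; suff uniq B C : is_type x p B -> is_type x p C -> B = C.
  by move=> xpA; apply: uniq => //; apply: (xgetI _ xpA).
have aux (s t M m : R) :
    s <= M -> m <= t -> s - t = M - m -> s = M /\ t = m.
  by clear => sM mt e; split; lra.
set w := tp_repr x - tp_repr p.
have winj : injective (w ord0).
  suff H (a b : 'I_n.+1) : (b < a)%N -> w ord0 a <> w ord0 b.
    move=> a b wab; apply/eqP; apply: contra_eqT wab => ab; apply/eqP => wab.
    move: ab; rewrite -val_eqE neq_ltn => /orP[] /H; first by rewrite wab.
    exact.
  move=> ba wab; apply: xp; exists (braid_hyperplane p a b); first by exists a, b.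
  by move: wab; rewrite /braid_hyperplane /= /coord_diff !mxE => ?; lra.
have [i wi] := max_coord_attained w; have [j wj] := min_coord_attained w.
suff H D : is_type x p D -> D = [set i; j]%SET by move=> /H -> /H ->.
move=> [a [b [_ -> /eqP]]].
have -> : coord_diff x a b - coord_diff p a b = w ord0 a - w ord0 b.
  by rewrite /coord_diff !mxE; lra.
rewrite /trop_dist -/w eqf_sqr wi wj.
move=> /orP[] /eqP e.
  have [/winj -> /winj ->//] : w ord0 a = w ord0 i /\ w ord0 b = w ord0 j.
  by apply: aux; rewrite // -?wi -?wj ?le_max_coord ?ge_min_coord.
have [/winj -> /winj ->] : w ord0 b = w ord0 i /\ w ord0 a = w ord0 j.
  apply: aux; rewrite -?wi -?wj ?le_max_coord ?ge_min_coord // wi wj.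
  by rewrite e opprB.
by rewrite finset.setUC.
Qed.

End TropicalProjectiveTorus.

Arguments tp_torus : clear implicits.

(* Main.v *)
Require Import Defs.
From mathcomp Require Import all_boot all_order all_algebra.
From mathcomp Require Import all_classical all_reals all_analysis.
From mathcomp Require Import lra.

(** The type of a point relative to [p] is read off from the order of the
coordinates of [x - p]: it is the pair formed by an index of a largest and an
index of a smallest coordinate ([trop_dist_offsetE]). That order is recorded by
the signs of the offsets [(x - p)_i - (x - p)_j], which are continuous in [x]
([offset_continuous]) and which vanish, for [i != j], only on the hyperplanes
of the braid arrangement at [p] ([offset_neq0]). A chamber is connected and
misses all these hyperplanes for every [p] in [S], so by the intermediate value
theorem ([connected_ge0]) no offset changes sign on it. Hence all points of a
chamber have the same type relative to each [p] in [S]. *)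

Set Implicit Arguments.
Unset Strict Implicit.
Unset Printing Implicit Defensive.

Import Order.TTheory GRing.Theory Num.Theory.
Import numFieldNormedType.Exports.

Local Open Scope classical_set_scope.
Local Open Scope ring_scope.

Lemma connected_ge0 (R : realType) (T : topologicalType) (C : set T)
    (f : T -> R) (x y : T) :
  connected C -> continuous f -> (forall z, C z -> f z != 0) ->
  C x -> C y -> 0 <= f x -> 0 <= f y.
Proof.
move=> cC cf f0 Cx Cy fx0; rewrite leNgt; apply/negP => fy0.
have /connected_intervalP fC : connected (f @` C).
  by apply: connected_continuous_connected => //; exact: continuous_subspaceT.
have [z Cz fz0] : (f @` C) 0.
  by apply: (fC (f y) (f x)); [exists y | exists x | rewrite (ltW fy0) fx0].
by have := f0 z Cz; rewrite fz0 eqxx.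
Qed.

(** This is [(x - p)_i - (x - p)_j], grouped so that each of the two terms is
well defined on the torus. *)
Definition offset (R : realType) (n : nat) (x p : tp_torus R n)
    (i j : 'I_n.+1) : R := coord_diff x i j - coord_diff p i j.

Section Offsets.
Context {R : realType} {n : nat}.
Implicit Types (x y p : tp_torus R n) (i j k : 'I_n.+1).

Lemma offset_reprE x p i j :
  offset x p i j = (tp_repr x - tp_repr p) ord0 i - (tp_repr x - tp_repr p) ord0 j.
Proof. by rewrite /offset /coord_diff !mxE; lra. Qed.

Lemma offsetC x p i j : offset x p j i = - offset x p i j.
Proof. by rewrite /offset /coord_diff; lra. Qed.

(** The choice of representatives need not be continuous; the coordinate differences
are, because they factor through the quotient map. *)
Lemma coord_diff_continuous i j : continuous (fun x => coord_diff x i j).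
Proof.
pose g (u : 'rV[R]_n.+1) : R := u ord0 i - u ord0 j.
have g_cont : continuous g.
  by move=> u; apply: continuousB; exact: coord_continuous.
suff : continuous (g \o repr : tp_torus R n -> R) by [].
apply: repr_comp_continuous => //.
move=> u v /eqP/tp_classP[c ->]; apply/eqP.
by rewrite /g !mxE; lra.
Qed.

Lemma offset_continuous p i j : continuous (fun x => offset x p i j).
Proof.
move=> x; have c_cont := @cst_continuous _ R (coord_diff p i j) x.
exact: (continuousB (@coord_diff_continuous i j x) c_cont).
Qed.

Lemma offset_neq0 (S : set (tp_torus R n)) x p i j : S p -> i != j ->
  arr_complement (braid_arrangement S) x -> offset x p i j != 0.
Proof.
(* The hyperplanes are indexed by ordered pairs only. *)
move=> Sp; wlog ltji : i j / (j < i)%N => [wlg ij Ax|_ Ax].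
  have [ltji|ltij|/val_inj eij] := ltngtP j i; first exact: wlg.
    by rewrite offsetC oppr_eq0 wlg // eq_sym.
  by rewrite eij eqxx in ij.
apply/eqP => /eqP; rewrite subr_eq0 => /eqP xH; apply: Ax.
by exists (braid_hyperplane p i j) => //; exists p => //; exists i, j.
Qed.

(** The right-hand side says that [x - p] is maximal at [i] and minimal at [j];
only signs occur in it, which is what makes the type locally constant. *)
Lemma trop_dist_offsetE x p i j :
  trop_dist x p = offset x p i j <->
  forall k, 0 <= offset x p i k /\ 0 <= offset x p k j.
Proof.
rewrite offset_reprE /trop_dist; set w := tp_repr x - tp_repr p.
have wE k l : offset x p k l = w ord0 k - w ord0 l by rewrite offset_reprE.
have := le_max_coord w i; have := ge_min_coord w j.
split=> [dE k|wij].
  by rewrite !wE; have := le_max_coord w k; have := ge_min_coord w k; split; lra.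
have [a wa] := max_coord_attained w; have [b wb] := min_coord_attained w.
have [+ _] := wij a; have [_ +] := wij b; rewrite !wE; lra.
Qed.

(** Squaring the distance makes the pair unordered. *)
Lemma is_typeE x p (A : {set 'I_n.+1}) :
  is_type x p A <->
  exists i j, [/\ i != j, A = [set i; j]%SET & trop_dist x p = offset x p i j].
Proof.
split=> [|] [i] [j] [ij ->]; last first.
  by move=> dE; exists i, j; rewrite dE.
move=> /eqP; rewrite eqf_sqr => /orP[] /eqP dE; first by exists i, j.
exists j, i; split; first by rewrite eq_sym.
  by rewrite finset.setUC.
by rewrite offsetC.
Qed.

Lemma is_type_offset_sign x y p (A : {set 'I_n.+1}) :
  (forall i j, 0 <= offset x p i j -> 0 <= offset y p i j) ->
  is_type x p A -> is_type y p A.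
Proof.
move=> xy /is_typeE[i [j [ij -> /trop_dist_offsetE xij]]].
apply/is_typeE; exists i, j; split => //; apply/trop_dist_offsetE => k.
by have [/xy ik /xy kj] := xij k.
Qed.

Lemma chamber_offset_ge0 (S C : set (tp_torus R n)) x y p i j :
  chambers (braid_arrangement S) C -> C x -> C y -> S p ->
  0 <= offset x p i j -> 0 <= offset y p i j.
Proof.
move=> [z _ <-] Cx Cy Sp.
have [->|ij] := eqVneq i j; first by rewrite !offset_reprE !subrr.
apply: (@connected_ge0 _ _ _ (fun t => offset t p i j)) Cx Cy.
- exact: component_connected.
- exact: offset_continuous.
- by move=> t /connected_component_sub; exact: offset_neq0.
Qed.

End Offsets.

Theorem proposition27 (R : realType) (n : nat) (S : set (tp_torus R n))
    (x y : tp_torus R n) :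
  finite_set S ->
  arr_complement (braid_arrangement S) x ->
  arr_complement (braid_arrangement S) y ->
  (exists C : set (tp_torus R n),
     [/\ chambers (braid_arrangement S) C, C x & C y]) ->
  types x S = types y S.
Proof.
move=> _ _ _ [C [chC Cx Cy]]; apply: eq_imagel => p Sp.
suff xyE : is_type x p = is_type y p by rewrite /type_of xyE.
apply/seteqP; split=> A; apply: is_type_offset_sign => i j.
  exact: chamber_offset_ge0 chC Cx Cy Sp.
exact: chamber_offset_ge0 chC Cy Cx Sp.
Qed.
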